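(* Let $l,m,n$ be non-negative integers. For a fixed partition $\kappa\subset\langle(m+n)^l\rangle$, there is a 1-to-1 correspondence between the sets (1) $\{(\mu,\nu):\mu\star_{m,n}\nu=\kappa'\}$ (pairs of partitions of length at most $m$ and $n$, respectively, whose $(m,n)$-overlap is $\kappa'$), and (2) $\{(\lambda,K):\lambda\subset\langle m^{n+l}\rangle,\ K\subset[n+l],\ l(K)=l\text{ and }\mathrm{sub}_{n+l}(\lambda,K)=\kappa\}$ (pairs consisting of a partition $\lambda$ and a subsequence $K$), given by the mapping from (2) to (1) $$(\lambda,K)\mapsto\left(\lambda',\ \mathrm{sub}_{n+l}\left(\tilde\lambda,C_{n+l}(K)\right)\right),$$ where $\tilde\lambda$ is the $(m,n+l)$-complement of $\lambda$.
   Context: A partition is a non-increasing sequence of non-negative integers; partitions differing only by trailing zeros are equal; its length is the number of positive parts, and $\lambda'$ is its conjugate. When used as a sequence of prescribed length, a partition is padded with zeros. $\langle m^n\rangle=(m,\dots,m)$ ($n$ entries); $\lambda\subset\langle m^n\rangle$ means containment of Ferrers diagrams, i.e. $\lambda$ has length at most $n$ and parts at most $m$. Sums of sequences are elementwise, and the union of two sequences is obtained by appending the second to the first. $[N]=(1,\dots,N)$; a subsequence $K\subset[N]$ is an increasing sequence of elements of $[N]$, of length $l(K)$. Complement: for $\lambda\subset\langle m^N\rangle$, the $(m,N)$-complement is $\tilde\lambda=(m-\lambda_N,\dots,m-\lambda_1)$. Subpartition: for a partition $\lambda$ of length at most $N$ and a subsequence $M\subset[N]$, $\mathrm{sub}_N(\lambda,M)$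 is the partition $\mu$ of length at most $l(M)$ with $\mu_j+l(M)-j=\lambda_{M_j}+N-M_j$ for all $1\le j\le l(M)$. For $K\subset[N]$, $C_N(K)$ is the subsequence of $[N]$ consisting (in increasing order) of the elements $N-j+1$ with $j\in[N]$, $j\notin K$. Overlap: $\rho_n=(n-1,\dots,1,0)$ ($\rho_0$ is empty). For partitions $\mu,\nu$ of length at most $m$ and $n$, respectively, the $(m,n)$-overlap $\mu\star_{m,n}\nu$ is the partition (of length at most $m+n$) such that $\mu\star_{m,n}\nu+\rho_{m+n}$ equals $(\mu+\rho_m)\cup(\nu+\rho_n)$ up to reordering, if it exists; otherwise $\mu\star_{m,n}\nu=\infty$, a symbol that is not a partition. *)

(* Defs.v *)
From HB Require Import structures.
From mathcomp Require Import all_boot zify.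
From mathcomp Require Export classical_sets functions.

Set Implicit Arguments.
Unset Strict Implicit.
Unset Printing Implicit Defensive.

(* Partitions, which are considered up to trailing zeros, are represented by
   the list of their positive parts: the length is then [size], and Leibniz
   equality is equality of partitions. *)
Definition is_part (s : seq nat) := sorted geq s && (0 \notin s).

Record intpart := IntPart {parts :> seq nat; partsP : is_part parts}.

HB.instance Definition _ := [isSub for parts].
HB.instance Definition _ := [Choice of intpart by <:].

Definition empty_part : intpart := @IntPart [::] isT.

(* The partition given by a non-increasing sequence [s], possibly with zeros;
   it is a dummy value when [s] is not non-increasing. *)
Definition part_of_seq (s : seq nat) : intpart :=
  insubd empty_part [seq x <- s | 0 < x].

(* [entry s i] is the entry s_i, with indices starting at 1; for a partition it
   is 0 beyond the length. *)
Definition entry (s : seq nat) (i : nat) : nat := nth 0 s i.-1.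

Definition pad (n : nat) (la : intpart) : seq nat :=
  [seq entry la i | i <- iota 1 n].

Definition in_rect (m n : nat) (la : intpart) : bool :=
  (size la <= n) && all (fun x => x <= m) la.

Definition conj_part (la : intpart) : intpart :=
  part_of_seq [seq count (fun x => j <= x) la | j <- iota 1 (entry la 1)].

Definition complement (m N : nat) (la : intpart) : intpart :=
  part_of_seq [seq m - x | x <- rev (pad N la)].

Definition subseq_of (N : nat) (K : seq nat) : bool := subseq K (iota 1 N).

(* The truncated subtraction is harmless when [M] is a subsequence of [N]; see
   [sub_partP]. *)
Definition sub_part (N : nat) (la : intpart) (M : seq nat) : intpart :=
  part_of_seq [seq entry la (entry M j) + (N - entry M j) - (size M - j)
              | j <- iota 1 (size M)].

(* [rev] puts the elements N - j + 1 in increasing order. *)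
Definition Cseq (N : nat) (K : seq nat) : seq nat :=
  rev [seq N - j + 1 | j <- iota 1 N & j \notin K].

Definition rho (n : nat) : seq nat := rev (iota 0 n).

Definition addseq (s t : seq nat) : seq nat := [seq p.1 + p.2 | p <- zip s t].

Definition is_overlap (m n : nat) (mu nu ka : intpart) : bool :=
  (size ka <= m + n) &&
  perm_eq (addseq (pad (m + n) ka) (rho (m + n)))
          (addseq (pad m mu) (rho m) ++ addseq (pad n nu) (rho n)).

(* [None] stands for the symbol infinity. The only candidate is computed by
   sorting; [overlapP] shows that the overlap is [Some ka] exactly when [ka]
   satisfies the defining property. *)
Definition overlap (m n : nat) (mu nu : intpart) : option intpart :=
  let s := sort geq (addseq (pad m mu) (rho m) ++ addseq (pad n nu) (rho n)) in
  let ka := part_of_seq [seq p.1 - p.2 | p <- zip s (rho (m + n))] in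
  if is_overlap m n mu nu ka then Some ka else None.

Lemma geq_trans : transitive geq.
Proof. by move=> y x z; rewrite /= => h1 h2; apply: leq_trans h2 h1. Qed.

Lemma part_of_seqE (s : seq nat) :
  sorted geq s -> parts (part_of_seq s) = [seq x <- s | 0 < x].
Proof.
move=> hs; rewrite /part_of_seq val_insubd ifT //.
by rewrite /is_part (sorted_filter geq_trans) //= mem_filter.
Qed.

Lemma size_part_of_seq (s : seq nat) : size (part_of_seq s) <= size s.
Proof.
rewrite /part_of_seq val_insubd; case: ifP => _ //.
by rewrite size_filter count_size.
Qed.

Lemma entry_part_of_seq (s : seq nat) (i : nat) :
  sorted geq s -> entry (part_of_seq s) i = entry s i.
Proof.
move=> hs; rewrite /entry part_of_seqE //; move: i.-1 => {}i.
elim: s i hs => [|x s IH] i //= hs.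
have hs' : sorted geq s by apply: path_sorted hs.
case: x hs => [|x] hs /=; last by case: i => [|i] //=; apply: IH.
have h0 : all (fun y => y == 0) s.
  have := order_path_min geq_trans hs; apply: sub_all => y /=.
  by rewrite leqn0.
rewrite (eq_in_filter (a2 := pred0)); last first.
  by move=> y /(allP h0) /eqP ->.
rewrite filter_pred0 nth_nil; case: i => [|i] //=.
have [hi|hi] := ltnP i (size s); last by rewrite nth_default.
by have /eqP -> := all_nthP 0 h0 i hi.
Qed.

Lemma intpart_ext (a b : intpart) : entry a =1 entry b -> a = b.
Proof.
move=> h; apply: val_inj => /=.
have nz (c : intpart) i : (nth 0 c i == 0) = (size c <= i).
  have [hi|hi] := ltnP i (size c); last by rewrite nth_default.
  apply/negbTE; apply/eqP => e; have /andP[_ /negP[]] := partsP c.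
  by rewrite -e mem_nth.
have h' i : nth 0 a i = nth 0 b i by apply: (h i.+1).
apply: (@eq_from_nth _ 0) => [|i _]; last exact: h'.
apply/eqP; rewrite eqn_leq -nz h' nz leqnn /=.
by rewrite -nz -h' nz.
Qed.

Lemma entry_iota (f : nat -> nat) (n j : nat) :
  0 < j <= n -> entry [seq f i | i <- iota 1 n] j = f j.
Proof.
case: j => // j /= hj.
by rewrite /entry /= (nth_map 0) ?size_iota // nth_iota.
Qed.

Lemma sorted_iota_map (f : nat -> nat) (n : nat) :
  (forall i, 0 < i < n -> f i.+1 <= f i) -> sorted geq [seq f i | i <- iota 1 n].
Proof.
move=> h; apply/(sortedP 0) => i; rewrite size_map size_iota => hi.
rewrite !(nth_map 0) ?size_iota //; try lia.
rewrite !nth_iota //; try lia.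
by rewrite add1n addnC addn1; apply: h; lia.
Qed.

Lemma entry_mono (la : intpart) (i j : nat) : i <= j -> entry la j <= entry la i.
Proof.
move=> hij; have /andP[hs _] := partsP la; rewrite /entry.
have [hj|hj] := ltnP j.-1 (size la); last by rewrite nth_default.
have := sorted_leq_nth geq_trans (fun x => leqnn x) 0 hs.
by move/(_ i.-1 j.-1); apply; rewrite ?inE //; lia.
Qed.

Lemma conj_partE (la : intpart) (j : nat) :
  0 < j -> entry (conj_part la) j = count (fun x => j <= x) la.
Proof.
move=> j0; rewrite entry_part_of_seq; last first.
  by apply: sorted_iota_map => i _; apply: sub_count => x /=; lia.
have [hj|hj] := leqP j (entry la 1); first by rewrite entry_iota ?j0.
rewrite {1}/entry nth_default ?size_map ?size_iota; last by move: hj; lia.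
apply/esym/eqP; rewrite -leqn0 leqNgt -has_count.
apply/negP => /hasP[x /(nthP 0)[i hi <-]].
have := entry_mono la (ltn0Sn i); rewrite [entry _ i.+1]/entry /=.
by move: hj; lia.
Qed.

Lemma complementP (m N : nat) (la : intpart) : in_rect m N la ->
  size (complement m N la) <= N /\
  forall j, 0 < j <= N -> entry (complement m N la) j = m - entry la (N.+1 - j).
Proof.
move=> _; split.
  by rewrite (leq_trans (size_part_of_seq _)) // size_map size_rev size_map size_iota.
have E : [seq m - x | x <- rev (pad N la)]
         = [seq m - entry la (N.+1 - j) | j <- iota 1 N].
  apply: (@eq_from_nth _ 0); rewrite ?size_map size_rev !size_map !size_iota //.
  move=> i hi; rewrite (nth_map 0) ?size_rev ?size_map ?size_iota //.
  rewrite nth_rev ?size_map ?size_iota // !(nth_map 0) ?size_iota //; try lia.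
  rewrite !nth_iota //; last by lia.
  by congr (_ - entry _ _); lia.
move=> j hj; rewrite /complement E entry_part_of_seq ?entry_iota //.
apply: sorted_iota_map => i _; apply: leq_sub2l; apply: entry_mono; lia.
Qed.

Lemma subseq_of_entry (N : nat) (M : seq nat) : subseq_of N M ->
  (forall j, 0 < j < size M -> entry M j < entry M j.+1) /\
  (forall j, 0 < j <= size M -> entry M j + (size M - j) <= N).
Proof.
move=> hM; have hs : sorted ltn M.
  by apply: subseq_sorted hM _ ; [exact: ltn_trans | exact: iota_ltn_sorted].
have hlt j : 0 < j < size M -> entry M j < entry M j.+1.
  case: j => // j hj; exact: (sortedP 0 hs).
split=> // j hj.
have hk k : j + k <= size M -> entry M j + k <= entry M (j + k).
  elim: k => [|k IH] hk; first by rewrite !addn0.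
  have h1 := IH ltac:(lia); have h2 := hlt (j + k) ltac:(lia).
  by rewrite !addnS; lia.
have := hk (size M - j) ltac:(lia); rewrite subnKC; last by lia.
move=> h; apply: (leq_trans h).
have : entry M (size M) \in M.
  by rewrite mem_nth // ltn_predL; case/andP: hj => a b; apply: leq_trans a b.
by move/(mem_subseq hM); rewrite mem_iota; lia.
Qed.

Lemma sub_partP (N : nat) (la : intpart) (M : seq nat) : subseq_of N M ->
  size (sub_part N la M) <= size M /\
  forall j, 0 < j <= size M ->
    entry (sub_part N la M) j + (size M - j)
    = entry la (entry M j) + (N - entry M j).
Proof.
move=> hM; have [h1 h2] := subseq_of_entry hM; split.
  by rewrite (leq_trans (size_part_of_seq _)) // size_map size_iota.
move=> j hj; rewrite entry_part_of_seq ?entry_iota //; first by have := h2 j hj; lia.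
apply: sorted_iota_map => i hi.
have a := h1 i hi; have b := h2 i ltac:(lia); have c := h2 i.+1 ltac:(lia).
by have d := entry_mono la (ltnW a); lia.
Qed.

Lemma overlapP (m n : nat) (mu nu ka : intpart) :
  overlap m n mu nu = Some ka <-> is_overlap m n mu nu ka.
Proof.
rewrite /overlap; split=> [|h]; first by case: ifP => // h [<-].
have /andP[hsz hp] := h; set s := sort _ _; set ka' := part_of_seq _.
suff -> : ka' = ka by rewrite h.
set t := addseq (pad (m + n) ka) (rho (m + n)) in hp.
have tE : t = [seq entry ka j + (m + n - j) | j <- iota 1 (m + n)].
  rewrite /t /addseq; apply: (@eq_from_nth _ 0).
    by rewrite !size_map size_zip size_map size_rev !size_iota minnn.
  move=> i; rewrite size_map size_zip size_map size_rev !size_iota minnn => hi.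
  rewrite (nth_map (0, 0)) ?size_zip ?size_map ?size_rev ?size_iota ?minnn //.
  rewrite nth_zip ?size_map ?size_rev ?size_iota //= !(nth_map 0) ?size_iota //.
  rewrite nth_rev ?size_iota // !nth_iota ?size_iota //; lia.
have st : s = t.
  apply: (sorted_eq geq_trans) => [x y /andP[] /= ? ?|||]; first by lia.
  - by apply: sort_sorted => x y /=; lia.
  - rewrite tE; apply: sorted_iota_map => i _.
    by have := entry_mono ka (leqnSn i); lia.
  - by rewrite perm_sort perm_sym.
have uE : [seq p.1 - p.2 | p <- zip s (rho (m + n))] = pad (m + n) ka.
  rewrite st tE; apply: (@eq_from_nth _ 0).
    by rewrite !size_map size_zip size_map size_rev !size_iota minnn.
  move=> i; rewrite size_map size_zip size_map size_rev !size_iota minnn => hi.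
  rewrite (nth_map (0, 0)) ?size_zip ?size_map ?size_rev ?size_iota ?minnn //.
  rewrite nth_zip ?size_map ?size_rev ?size_iota //= !(nth_map 0) ?size_iota //.
  rewrite nth_rev ?size_iota // !nth_iota ?size_iota //; lia.
have hsrt : sorted geq (pad (m + n) ka).
  by apply: sorted_iota_map => i _; apply: entry_mono.
apply: intpart_ext => i; rewrite /ka' uE entry_part_of_seq //.
have [hi|hi] := ltnP i.-1 (m + n).
  by rewrite /entry /pad (nth_map 0) ?size_iota // nth_iota.
rewrite /entry nth_default ?size_map ?size_iota // nth_default //.
exact: leq_trans hsz hi.
Qed.

(* Main.v *)
(* Encode a partition [la] of length at most [k] by its beta-set
   la + rho_k.  For la in the rectangle <a^b>, the beta-set of the conjugate
   is the complement in {0, ..., a+b-1} of the reflection x |-> a+b-1-x of the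
   beta-set of la (the boundary path of la read from both ends).  A subsequence
   K selects a subset of the beta-set B of lambda, which is the beta-set T of
   kappa; passing to the (m,n+l)-complement and to C(K) reflects the remaining
   elements B \ T.  Hence both "sub(lambda, K) = kappa" and "the overlap is
   kappa'" say that the reflection of B is the disjoint union of those of T
   and of the beta-set of nu. *)
Require Import Defs.
From mathcomp Require Import all_boot classical_sets functions.
From mathcomp Require Import zify.

Set Implicit Arguments.
Unset Strict Implicit.
Unset Printing Implicit Defensive.

(** * Beta-sets as strictly decreasing lists *)

Definition beta (k : nat) (la : intpart) : seq nat :=
  [seq entry la j + (k - j) | j <- iota 1 k].

Definition mirror (M x : nat) : nat := M - x.+1.

Lemma size_beta k la : size (beta k la) = k.
Proof. by rewrite size_map size_iota. Qed.

Lemma nth_beta k la i : i < k -> nth 0 (beta k la) i = entry la i.+1 + (k - i.+1).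
Proof. by move=> hi; rewrite (nth_map 0) ?size_iota // nth_iota. Qed.

Lemma gtn_trans : transitive gtn.
Proof. by move=> y x z /= hxy hyz; apply: ltn_trans hyz hxy. Qed.

Lemma beta_sorted k la : sorted gtn (beta k la).
Proof.
apply/(sortedP 0) => i; rewrite size_beta => hi /=.
rewrite !nth_beta //; last by lia.
by have := entry_mono la (leqnSn i.+1); lia.
Qed.

Lemma beta_uniq k la : uniq (beta k la).
Proof.
by apply: (sorted_uniq gtn_trans _ (beta_sorted k la)) => x /=; rewrite ltnn.
Qed.

Lemma gtn_sorted_eq (s t : seq nat) :
  sorted gtn s -> sorted gtn t -> s =i t -> s = t.
Proof.
apply: irr_sorted_eq; first exact: gtn_trans.
by move=> x /=; rewrite ltnn.
Qed.

Lemma intpart_extS (la mu : intpart) :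
  (forall i, entry la i.+1 = entry mu i.+1) -> la = mu.
Proof. by move=> h; apply: intpart_ext => -[|i]; [apply: (h 0)|apply: h]. Qed.

Lemma entry_eq0 (la : intpart) i : (entry la i.+1 == 0) = (size la <= i).
Proof.
rewrite /entry /=; have [hi|hi] := ltnP i (size la); last by rewrite nth_default.
apply/negbTE; apply/eqP => e; have /andP[_ /negP[]] := partsP la.
by rewrite -e mem_nth.
Qed.

Lemma beta_inj k (la mu : intpart) :
  size la <= k -> size mu <= k -> beta k la = beta k mu -> la = mu.
Proof.
move=> hla hmu e; apply: intpart_extS => i; have [hi|hi] := ltnP i k.
  by have := congr1 (nth 0 ^~ i) e; rewrite !nth_beta // => /addIn.
have /eqP -> : entry la i.+1 == 0 by rewrite entry_eq0 (leq_trans hla hi).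
by apply/esym/eqP; rewrite entry_eq0 (leq_trans hmu hi).
Qed.

Lemma addseq_pad_rho k la : addseq (pad k la) (rho k) = beta k la.
Proof.
apply: (@eq_from_nth _ 0).
  by rewrite !size_map size_zip size_map size_rev !size_iota minnn.
move=> i; rewrite size_map size_zip size_map size_rev !size_iota minnn => hi.
rewrite (nth_map (0, 0)) ?size_zip ?size_map ?size_rev ?size_iota ?minnn //.
rewrite nth_zip ?size_map ?size_rev ?size_iota //= !(nth_map 0) ?size_iota //.
by rewrite nth_rev ?size_iota // !nth_iota ?size_iota //; lia.
Qed.

Lemma overlap_beta m n (mu nu ka : intpart) :
  overlap m n mu nu = Some ka <->
  size ka <= m + n /\ perm_eq (beta (m + n) ka) (beta m mu ++ beta n nu).
Proof.
rewrite overlapP /is_overlap !addseq_pad_rho.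
by split=> [/andP[]|[-> ->]].
Qed.

(** * Rectangles, conjugation and beta-sets *)

Lemma in_rectE m k (la : intpart) :
  in_rect m k la = (size la <= k) && (entry la 1 <= m).
Proof.
rewrite /in_rect; congr (_ && _); apply/allP/idP => [h|h x].
  rewrite /entry; case e : (parts la) => [|x s] //=.
  by apply: h; rewrite e mem_head.
move=> /(nthP 0)[i _ <-].
exact: leq_trans (entry_mono la (ltn0Sn i)) h.
Qed.

(** In a non-increasing list the elements that are at least [j] form an initial segment. Since [j]
    is positive, the default value 0 of [nth] past the end fails the test as it should. *)
Lemma ltn_count_sorted (s : seq nat) i j : sorted geq s -> 0 < j ->
  (i < count (leq j) s) = (j <= nth 0 s i).
Proof.
move=> hs j0; elim: s i hs => [|x s IH] i hs /=; first by rewrite nth_nil; lia.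
have [hx|hx] := leqP j x; first by case: i => [|i] //=; apply: IH (path_sorted hs).
have hall : all (fun y => y <= x) s := order_path_min geq_trans hs.
have -> : count (leq j) s = 0.
  rewrite (@eq_in_count _ _ pred0) ?count_pred0 // => y /(allP hall) /=; lia.
case: i => [|i] /=; first by lia.
have [hi|hi] := ltnP i (size s); last by rewrite nth_default //; lia.
by have /= := all_nthP 0 hall i hi; lia.
Qed.

(** Symmetry of Ferrers diagrams under transposition: both sides say that [la] has a cell in row [i]
    and column [j]. *)
Lemma leq_entry_conj (la : intpart) i j :
  0 < i -> 0 < j -> (i <= entry (conj_part la) j) = (j <= entry la i).
Proof.
case: i => // i _ j0; rewrite conj_partE // ltn_count_sorted //.
by have /andP[] := partsP la.
Qed.

Lemma conj_partK : involutive conj_part.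
Proof.
move=> la; apply: intpart_extS => i.
have h j : 0 < j ->
    (j <= entry (conj_part (conj_part la)) i.+1) = (j <= entry la i.+1).
  by move=> j0; rewrite !leq_entry_conj.
(* Numbers with the same positive lower bounds are equal: otherwise the successor of the smaller one
   bounds only the larger one. *)
apply/eqP; rewrite eqn_leq; apply/andP; split; rewrite leqNgt; apply/negP => e.
  by have := h (entry la i.+1).+1 isT; rewrite e ltnn.
by have := h (entry (conj_part (conj_part la)) i.+1).+1 isT; rewrite e ltnn.
Qed.

Lemma in_rect_conj m k (la : intpart) :
  in_rect m k la -> in_rect k m (conj_part la).
Proof.
rewrite !in_rectE => /andP[h1 h2]; apply/andP; split.
  by rewrite -entry_eq0 -leqn0 leqNgt leq_entry_conj // -leqNgt.
by rewrite leqNgt leq_entry_conj // -leqNgt leqn0 entry_eq0.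
Qed.

Lemma beta_lt m k (la : intpart) : in_rect m k la -> {in beta k la, forall x, x < m + k}.
Proof.
rewrite in_rectE => /andP[_ h] x /mapP[j]; rewrite mem_iota => hj ->.
by have := entry_mono la (i := 1) (j := j) ltac:(lia); lia.
Qed.

Lemma mirror_inj M (s : seq nat) :
  {in s, forall x, x < M} -> {in s &, injective (mirror M)}.
Proof. by move=> h x y /h hx /h hy; rewrite /mirror; lia. Qed.

Lemma beta_conj_perm a b (la : intpart) : in_rect a b la ->
  perm_eq (beta a (conj_part la) ++ map (mirror (a + b)) (beta b la))
          (iota 0 (a + b)).
Proof.
move=> h; set s := _ ++ _.
have hu : uniq s.
  rewrite cat_uniq beta_uniq map_inj_in_uniq ?beta_uniq ?andbT /=; last first.
    by apply: mirror_inj; apply: beta_lt.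
  apply/hasPn => _ /mapP[_ /mapP[i hi ->] ->]; apply/negP => /mapP[j hj].
  move: hi hj; rewrite !mem_iota /mirror => hi hj e.
  (* Write la' for the conjugate. A common element would give (la'_j - i) + (la_i - j) = -1 over the
     integers, so exactly one of i <= la'_j and j <= la_i would hold, against the transposition
     symmetry. The bound proved next makes the truncated subtraction in [mirror] exact. *)
  have := leq_entry_conj la (i := i) (j := j) ltac:(lia) ltac:(lia).
  have : entry la i + (b - i) < a + b.
    by apply: (beta_lt h); apply/mapP; exists i; rewrite // mem_iota.
  by lia.
have hsub : {subset s <= iota 0 (a + b)}.
  move=> x; rewrite mem_iota mem_cat => /orP[hx|/mapP[y hy ->]].
    by have := beta_lt (in_rect_conj h) hx; lia.
  by have := beta_lt h hy; rewrite /mirror; lia.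
apply: uniq_perm => //; first exact: iota_uniq.
(* Pigeonhole: [a + b] distinct numbers below [a + b] exhaust the interval. *)
have hsz : size (iota 0 (a + b)) <= size s.
  by rewrite size_cat size_map !size_beta size_iota.
by have [] := uniq_min_size hu hsub hsz.
Qed.

(** * Subpartitions as selections from beta-sets *)

Lemma beta_sub_part N (la : intpart) (K : seq nat) : subseq_of N K ->
  beta (size K) (sub_part N la K) = [seq nth 0 (beta N la) i.-1 | i <- K].
Proof.
move=> hK; have [_ h] := sub_partP la hK.
apply: (@eq_from_nth _ 0); rewrite ?size_beta ?size_map // => i hi.
rewrite nth_beta // h // (nth_map 0) //.
have : nth 0 K i \in iota 1 N by apply: (mem_subseq hK); apply: mem_nth.
by rewrite mem_iota /entry /= => hk; rewrite nth_beta /entry; [congr (nth _ _ _ + _) |]; lia.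
Qed.

Lemma Cseq_subseq N K : subseq_of N (Cseq N K).
Proof.
rewrite /subseq_of; have -> : iota 1 N = rev [seq N - j + 1 | j <- iota 1 N].
  apply: (@eq_from_nth _ 0); rewrite ?size_rev ?size_map ?size_iota // => i hi.
  rewrite nth_rev ?size_map ?size_iota // (nth_map 0) ?size_iota; last by lia.
  by rewrite !nth_iota; lia.
by rewrite /Cseq subseq_rev; apply: map_subseq; apply: filter_subseq.
Qed.

(** At position N - i + 1 the beta-set of the complement has m - la_i + (i - 1), which is the
    reflection of la_i + (N - i). The outer [rev] comes from [Cseq]. *)
Lemma beta_complement_Cseq m N (la : intpart) (K : seq nat) : in_rect m N la ->
  [seq nth 0 (beta N (complement m N la)) i.-1 | i <- Cseq N K] =
  rev (map (mirror (m + N))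
        [seq nth 0 (beta N la) i.-1 | i <- iota 1 N & i \notin K]).
Proof.
move=> h; have [_ hc] := complementP h.
rewrite /Cseq map_rev -!map_comp; congr rev; apply/eq_in_map => i.
rewrite mem_filter mem_iota => /andP[_ hi] /=.
rewrite !nth_beta ?hc /mirror; try lia.
have := entry_mono la (i := 1) (j := i) ltac:(lia).
have -> : N.+1 - (N - i + 1).-1.+1 = i by lia.
have -> : i.-1.+1 = i by lia.
by move: h; rewrite in_rectE => /andP[]; lia.
Qed.

Lemma beta_nth_iota N (la : intpart) :
  beta N la = [seq nth 0 (beta N la) i.-1 | i <- iota 1 N].
Proof.
apply: (@eq_from_nth _ 0); rewrite ?size_beta ?size_map ?size_iota // => i hi.
by rewrite (nth_map 0) ?size_iota // nth_iota.
Qed.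

Lemma beta_split N (la : intpart) (K : seq nat) : subseq_of N K ->
  perm_eq ([seq nth 0 (beta N la) i.-1 | i <- K] ++
           [seq nth 0 (beta N la) i.-1 | i <- iota 1 N & i \notin K])
          (beta N la).
Proof.
move=> hK; rewrite -map_cat.
rewrite [X in perm_eq _ X]beta_nth_iota; apply: perm_map.
have {1}-> : K = [seq i <- iota 1 N | i \in K].
  exact: (subseq_uniqP (iota_uniq 1 N) hK).
exact: permEl (perm_filterC _ _).
Qed.

(** The map sends (2) into (1). Appending the reflected beta-set of [sub_part (n + l) la K] to both
    sides of the overlap condition turns each side into a rearrangement of {0, ..., m+n+l-1}, by
    [beta_conj_perm] for that subpartition and for [la]. *)
Lemma overlap_sub_part l m n (la : intpart) (K : seq nat) :
  in_rect m (n + l) la -> subseq_of (n + l) K -> size K = l ->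
  in_rect (m + n) l (sub_part (n + l) la K) ->
  size (sub_part (n + l) (complement m (n + l) la) (Cseq (n + l) K)) <= n /\
  overlap m n (conj_part la)
    (sub_part (n + l) (complement m (n + l) la) (Cseq (n + l) K)) =
  Some (conj_part (sub_part (n + l) la K)).
Proof.
move=> hla hK sK hka; set ka := sub_part _ la K; set nu := sub_part _ _ _.
have hC := Cseq_subseq (n + l) K.
have hsplit := beta_split la hK; set U := map _ (filter _ _) in hsplit.
rewrite -beta_sub_part // sK -/ka in hsplit.
(* [U] and [Cseq] run over the same filtered indices, and [U] is what remains of n + l elements once
   l are selected. *)
have sC : size (Cseq (n + l) K) = n.
  have := perm_size hsplit; rewrite size_cat !size_beta /U size_map.
  by rewrite /Cseq size_rev size_map => h; apply: (@addnI l); rewrite [RHS]addnC.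
have hnu : perm_eq (beta n nu) (map (mirror (m + (n + l))) U).
  by rewrite -{1}sC beta_sub_part // beta_complement_Cseq // perm_rev.
split; first by have [h _] := sub_partP (complement m (n + l) la) hC; rewrite -sC.
apply/overlap_beta; split.
  by have := in_rect_conj hka; rewrite in_rectE => /andP[].
have hk := beta_conj_perm hka; rewrite -addnA in hk.
rewrite -(perm_cat2r (map (mirror (m + (n + l))) (beta l ka))).
apply: (perm_trans hk); rewrite perm_sym.
apply: perm_trans (beta_conj_perm hla).
rewrite -catA perm_cat2l.
apply: (perm_trans (y := map (mirror (m + (n + l))) U ++
                         map (mirror (m + (n + l))) (beta l ka))).
  by rewrite perm_cat2r.
by rewrite perm_catC -map_cat; apply: perm_map.
Qed.

(** The witness consists of the positions at which the beta-set of [la] takes values in that of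
    [ka]. *)
Lemma exists_sub_part N k (la ka : intpart) : size ka <= k ->
  {subset beta k ka <= beta N la} ->
  exists K, [/\ subseq_of N K, size K = k & sub_part N la K = ka].
Proof.
move=> ska hsub; pose K := [seq i <- iota 1 N | nth 0 (beta N la) i.-1 \in beta k ka].
have hK : subseq_of N K := filter_subseq _ _.
have eK : [seq nth 0 (beta N la) i.-1 | i <- K] = beta k ka.
  rewrite /K -(filter_map _ (mem (beta k ka))) -beta_nth_iota.
  (* Both lists are strictly decreasing, so it suffices to compare their elements. *)
  apply: gtn_sorted_eq.
  - exact: sorted_filter gtn_trans _ _ (beta_sorted N la).
  - exact: beta_sorted.
  by move=> x; rewrite mem_filter; apply/andb_idr/hsub.
have sK : size K = k by rewrite -(size_beta k ka) -eK size_map.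
exists K; split=> //; apply: (@beta_inj k) => //.
  by have [+ _] := sub_partP la hK; rewrite sK.
by rewrite -{1}sK beta_sub_part.
Qed.

(** A beta-set has no repetitions, so the selected values determine their positions. *)
Lemma sub_part_inj N (la : intpart) (K1 K2 : seq nat) :
  subseq_of N K1 -> subseq_of N K2 -> size K1 = size K2 ->
  sub_part N la K1 = sub_part N la K2 -> K1 = K2.
Proof.
move=> h1 h2 hs e; have := beta_sub_part la h1.
rewrite e hs beta_sub_part // => /esym; apply: (inj_in_map (A := mem (iota 1 N))).
- move=> i j; rewrite !mem_iota => hi hj /eqP.
  by rewrite nth_uniq ?size_beta ?beta_uniq; lia.
- by apply/allP => x /(mem_subseq h1).
- by apply/allP => x /(mem_subseq h2).
Qed.

Theorem proposition4p15 (l m n : nat) (kappa : intpart) :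
  in_rect (m + n) l kappa ->
  set_bij
    [set lK : intpart * seq nat |
      [/\ in_rect m (n + l) lK.1, subseq_of (n + l) lK.2, size lK.2 = l
        & sub_part (n + l) lK.1 lK.2 = kappa]]%classic
    [set mn : intpart * intpart |
      [/\ size mn.1 <= m, size mn.2 <= n
        & overlap m n mn.1 mn.2 = Some (conj_part kappa)]]%classic
    (fun lK => (conj_part lK.1,
                sub_part (n + l) (complement m (n + l) lK.1)
                         (Cseq (n + l) lK.2))).
Proof.
move=> hka; split.
- move=> [la K] /= [hla hK sK e].
  have := overlap_sub_part hla hK sK; rewrite e => /(_ hka) [h1 h2]; split=> //.
  by have := in_rect_conj hla; rewrite in_rectE => /andP[].
(* Injectivity: the first components determine lambda because conjugation is an involution; then
   [kappa] determines K. *)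
- move=> [la1 K1] [la2 K2]; rewrite !inE /=.
  move=> [_ hK1 s1 e1] [_ hK2 s2 e2] [/(can_inj conj_partK) e _].
  subst la2; congr (_, _).
  by apply: (sub_part_inj (la := la1) hK1 hK2); rewrite ?s1 ?e1.
- move=> [mu nu] /= [smu snu /overlap_beta [_ hp]].
  have hla : in_rect m (n + l) (conj_part mu).
    apply: in_rect_conj; rewrite in_rectE smu /=.
    (* For m = 0, [mu] is empty. Otherwise mu_1 + m - 1 lies in the beta-set of kappa', hence is
       below m + n + l, which gives mu_1 <= n + l. *)
    case: m smu hka hp => [|m'] smu hka hp.
      by have : entry mu 1 == 0; [rewrite entry_eq0 | move/eqP->].
    have : entry mu 1 + (m'.+1 - 1) \in beta (m'.+1 + n) (conj_part kappa).
      rewrite (perm_mem hp) mem_cat; apply/orP; left.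
      by apply/mapP; exists 1; rewrite // mem_iota.
    by move/(beta_lt (in_rect_conj hka)); lia.
  have hB := beta_conj_perm hla; rewrite conj_partK in hB.
  have hT := beta_conj_perm hka; rewrite -addnA in hT.
  (* Cancelling the beta-set of [mu] from two decompositions of {0, ..., m+n+l-1} gives the
     inclusion for the reflected sets; the reflection is injective on this interval. *)
  have hsub : {subset beta l kappa <= beta (n + l) (conj_part mu)}.
    have hnuT : perm_eq (beta n nu ++ map (mirror (m + (n + l))) (beta l kappa))
                  (map (mirror (m + (n + l))) (beta (n + l) (conj_part mu))).
      rewrite -(perm_cat2l (beta m mu)) catA perm_sym.
      apply: (perm_trans hB); rewrite perm_sym; apply: perm_trans hT.
      by rewrite perm_cat2r perm_sym.
    move=> x hx; have := map_f (mirror (m + (n + l))) hx.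
    move=> hx'; have : mirror (m + (n + l)) x \in
        map (mirror (m + (n + l))) (beta (n + l) (conj_part mu)).
      by rewrite -(perm_mem hnuT) mem_cat hx' orbT.
    case/mapP => y hy; have := beta_lt hka hx; have := beta_lt hla hy.
    by rewrite /mirror => h1 h2 e; have -> : x = y by lia.
  have ska : size kappa <= l by move: hka; rewrite in_rectE => /andP[].
  have [K [hK sK e]] := exists_sub_part ska hsub.
  exists (conj_part mu, K) => //=.
  have := overlap_sub_part hla hK sK; rewrite e conj_partK.
  case/(_ hka) => snu' /overlap_beta [_ hp'].
  (* The constructed partition and [nu] both overlap with [mu] to kappa', so cancelling the beta-set
     of [mu] identifies their beta-sets. *)
  congr (_, _); apply: (beta_inj snu' snu); apply: gtn_sorted_eq; try exact: beta_sorted.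
  apply: perm_mem; rewrite -(perm_cat2l (beta m mu)).
  by apply: perm_trans hp; rewrite perm_sym.
Qed.
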